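(* Fix $t\in\mathbb{R}$ and let $\alpha_{i,n}$ be the local levels of the one-sided HC test with critical values $h_{i,n}(d_n(t))$. Let $i_n\in\{1,\dots,n\}$ be a sequence of ranks with $i_n/u_n\to0$ as $n\to\infty$. Then $$\alpha_{i_n,n}=\frac{1}{\sqrt{2\pi i_n}}\Bigl(\gamma\frac{i_n}{u_n}\Bigr)^{i_n}\exp(-i_nv_n)\Bigl[1+O\Bigl(\frac1{i_n}\Bigr)+o(1)\Bigr],$$ where $\gamma=\exp(1)/2$ and $$v_n=\frac{\log(u_n)+2t-\log(\pi)+3i_n}{2u_n}\,[1+o(1)].$$ Alternatively, if in addition $i_n=o(\sqrt{u_n})$, then $$\alpha_{i_n,n}=\Bigl(\frac{i_n^2}{2u_n}\Bigr)^{i_n}\frac1{i_n!}\,[1+o(1)].$$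
   Context: Let $u_n=\log(\log(n))$ and, for fixed $t\in\mathbb{R}$, $d_n(t)=\bigl(t+2u_n+(\log(u_n)-\log(\pi))/2\bigr)/\sqrt{2u_n}$ (everything is considered for $n$ large enough to be defined with $d_n(t)\ge1$). For $1\le i\le n$ let $$h_{i,n}(d)=\frac{d^2+2i-d\sqrt{d^2+4i-4i^2/n}}{2(d^2+n)}.$$ The local levels of the one-sided higher criticism (HC) test based on $d_n(t)$ are $\alpha_{i,n}=\mathbb{P}(U_{i:n}<h_{i,n}(d_n(t)))=\mathbb{P}(Z_n\ge i)$, where $U_{i:n}$ is the $i$th order statistic of $n$ i.i.d. uniform random variables on $[0,1]$ and $Z_n$ is binomial with parameters $n$ and $h_{i,n}(d_n(t))$. Asymptotic symbols refer to $n\to\infty$; the first formula means that there is a sequence $v_n$ with the stated asymptotics for which it holds. *)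

(* Defs.v *)
From HB Require Import structures.
From mathcomp Require Export all_boot all_order all_algebra.
From mathcomp Require Export all_classical all_reals all_analysis.
Export Order.TTheory GRing.Theory Num.Theory.
Export numFieldNormedType.Exports.

Set Implicit Arguments.
Unset Strict Implicit.
Unset Printing Implicit Defensive.

Local Open Scope classical_set_scope.
Local Open Scope ring_scope.

Section IidUniform.
Context {d : measure_display} {T : measurableType d} {R : realType}
  {P : probability T R} {n : nat}.

(* The product rule over every subfamily S of the finite family U. *)
Definition mutually_independent (U : 'I_n -> {RV P >-> R}) : Prop :=
  forall (S : {set 'I_n}) (B : 'I_n -> set R),
    (forall j, measurable (B j)) ->
    P (\bigcap_(j in [set` S]) (U j @^-1` B j))
      = (\prod_(j in S) P (U j @^-1` B j))%E.

(* [distribution] and [uniform_prob] are defined on all sets but are only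
   meaningful on measurable ones, whence the restriction. *)
Definition uniform01 (X : {RV P >-> R}) : Prop :=
  forall B : set R, measurable B ->
    distribution P X B = uniform_prob (@ltr01 R) B.

Definition iid_uniform01 (U : 'I_n -> {RV P >-> R}) : Prop :=
  mutually_independent U /\ (forall j, uniform01 (U j)).

(* Ranks start at 1: the i-th smallest value has index i.-1 in the sorted
   sample. Only 1 <= i <= n is meaningful. *)
Definition order_stat (U : 'I_n -> {RV P >-> R}) (i : nat) (w : T) : R :=
  nth 0 (sort <=%R [seq U j w | j <- enum 'I_n]) i.-1.

End IidUniform.

Section HigherCriticism.
Context {R : realType}.

(* [ln] is 0 on nonpositive reals, so [hc_u] and [hc_d] have junk values for
   small n. *)
Definition hc_u (n : nat) : R := ln (ln n%:R).

Definition hc_d (t : R) (n : nat) : R :=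
  (t + 2 * hc_u n + (ln (hc_u n) - ln pi) / 2) / Num.sqrt (2 * hc_u n).

Definition hc_crit (i n : nat) (d : R) : R :=
  (d ^+ 2 + 2 * i%:R
     - d * Num.sqrt (d ^+ 2 + 4 * i%:R - 4 * i%:R ^+ 2 / n%:R))
  / (2 * (d ^+ 2 + n%:R)).

Definition hc_level {dp : measure_display} {T : measurableType dp}
    {P : probability T R} (t : R) {n : nat} (U : 'I_n -> {RV P >-> R})
    (i : nat) : R :=
  fine (P [set w | order_stat U i w < hc_crit i n (hc_d t n)]).

End HigherCriticism.

(* Main.v *)
Require Import Defs.
From mathcomp Require Import measurable_realfun ring lra.

(** Write u = log log n, d for the boundary value [hc_d t n], i for the rank
and x = n h for the expected number of observations below the critical value
h.  The level is the binomial tail P(Z >= i), Z ~ Bin(n, h), and the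
hypothesis i / u -> 0 puts it in a large deviation Poisson regime.

Poisson regime.  Since x / i is of order i / u -> 0, consecutive terms of the
tail have ratio at most about x / i, so the tail is asymptotic to its first
term; since i^2 / n -> 0 (n is at least u^3 / 6), that term is asymptotic to
the Poisson weight x^i exp(-x) / i!.  Both facts are combined in explicit
two-sided bounds, [binomial_tail_poisson].

Expansion of x.  The critical value solves i - x = d sqrt(x (1 - x / n)).
Rationalising its formula gives x = i s / y, where s = i / d^2 and
y = (1 + 2 s + sqrt(1 + 4 s (1 - i / n))) / 2 ([hc_crit_closed]).  With
q = t + (ln u - ln pi) / 2 and w = q / (2 u) one has d^2 = 2 u (1 + w)^2, hence
x^i exp(-x) = (i^2 / (2 u))^i exp(-i v) for
v = 2 ln(1 + w) + ln y + s / y.  To first order ln y is 2 s and s / y is s,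
with s about i / (2 u), so v is about 2 w + 3 i / (2 u), which is
(ln u + 2 t - ln pi + 3 i) / (2 u): one of the three units of i / (2 u) comes
from the factor exp(-x), the other two from x^i.  All error terms are second
order in w and i / u, hence of smaller order than this leading term, which is
a positive combination of w and i / u ([hc_exponent_bounds]).

Conclusion.  The level is therefore
(i^2 / (2 u))^i exp(-i v) / i! [1 + o(1)].  The first formula replaces i! by
Stirling's approximation; its relative error is O(1 / i) uniformly in i,
whether or not i tends to infinity, so a bound valid for every i >= 1 is
proved ([stirling]).  For the second formula, i = o(sqrt u) gives i v -> 0,
because q / sqrt u -> 0, and the exponential factor disappears. *)

Set Implicit Arguments.
Unset Strict Implicit.
Unset Printing Implicit Defensive.

Local Open Scope classical_set_scope.
Local Open Scope ring_scope.

(** * Monotonicity and bounds for the logarithm *)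

Lemma derive_ge0_le (R : realType) (f df : R -> R) (a b : R) :
  a <= b ->
  (forall x, a <= x <= b -> is_derive x 1 f (df x)) ->
  (forall x, a <= x <= b -> 0 <= df x) -> f a <= f b.
Proof.
move=> ab fdf df_ge0.
have cf : {within `[a, b], continuous f}.
  apply: derivable_within_continuous => x; rewrite in_itv /= => /fdf.
  by move=> [].
have [|c] := MVT_segment ab _ cf (df := df).
  by move=> x; rewrite in_itv /= => /andP[ax xb]; apply: fdf; rewrite !ltW.
rewrite in_itv /= => cab fba; rewrite -subr_ge0 fba mulr_ge0 ?subr_ge0//.
exact: df_ge0.
Qed.

Lemma is_derive_ln1p (R : realType) (x : R) : 0 <= x ->
  is_derive x 1 (fun y : R => ln (1 + y)) (1 + x)^-1.
Proof.
move=> x0; have x1 : 0 < 1 + x by lra.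
have dl := is_derive1_ln x1.
have d1 : is_derive x 1 (fun y : R => 1 + y) 1.
  by apply: is_derive_eq; rewrite add0r mulr1.
by apply: (is_derive_eq (is_derive1_comp dl d1)); rewrite mulr1.
Qed.

Lemma ln1p_ge (R : realType) (x : R) : 0 <= x -> x - x ^+ 2 / 2 <= ln (1 + x).
Proof.
move=> x0; rewrite -subr_ge0.
pose f (y : R) := ln (1 + y) - (y - y ^+ 2 / 2).
suff : f 0 <= f x by rewrite /f addr0 ln1 expr0n /= mul0r !subr0.
apply: (@derive_ge0_le _ f (fun y => (1 + y)^-1 - (1 - y)) _ _ x0) => y /andP[y0 _].
  have dl := is_derive_ln1p y0; rewrite /f.
  apply: is_derive_eq; rewrite /GRing.scale /=; field; lra.
rewrite /= subr_ge0 -[_^-1]mul1r ler_pdivlMr; nra.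
Qed.

Lemma ln1p_le (R : realType) (x : R) : 0 <= x ->
  ln (1 + x) <= x - x ^+ 2 / 2 + x ^+ 3 / 3.
Proof.
move=> x0; rewrite -subr_ge0.
pose f (y : R) := y - y ^+ 2 / 2 + y ^+ 3 / 3 - ln (1 + y).
suff : f 0 <= f x by rewrite /f addr0 ln1 !expr0n /= !mul0r !(subr0, addr0).
apply: (@derive_ge0_le _ f (fun y => 1 - y + y ^+ 2 - (1 + y)^-1) _ _ x0).
  move=> y /andP[y0 _]; have dl := is_derive_ln1p y0; rewrite /f.
  apply: is_derive_eq; rewrite /GRing.scale /=; field; lra.
move=> y /andP[y0 _]; rewrite /= subr_ge0 -[_^-1]mul1r ler_pdivrMr; nra.
Qed.

(** * Wallis integrals *)

(** The antiderivative of sin^n given by the usual reduction formula.  Working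
with it directly yields the Wallis inequalities by differentiation alone,
without any integral. *)
Fixpoint sin_pow_prim (R : realType) (n : nat) (x : R) : R :=
  match n with
  | 0 => x
  | 1 => - cos x
  | m.+2 => (m.+1%:R * sin_pow_prim m x - cos x * sin x ^+ m.+1) / m.+2%:R
  end.

Lemma is_derive_sin_pow_prim (R : realType) (n : nat) (x : R) :
  is_derive x 1 (sin_pow_prim n) (sin x ^+ n).
Proof.
have [k] := ubnP n; elim: k n => // k IH [|[|n]] nk.
- by rewrite expr0; exact: is_derive_id.
- by rewrite /sin_pow_prim; apply: is_derive_eq; rewrite opprK expr1.
have {}IH := IH n (@ltnW n.+1 k nk).
rewrite [sin_pow_prim _]/=.
have dX : is_derive x 1 (fun y => sin y ^+ n.+1) (n.+1%:R * sin x ^+ n * cos x).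
  have := is_deriveX n.+1 (is_derive_sin x).
  by rewrite exprfctE.
apply: is_derive_eq.
rewrite /GRing.scale /=.
have -> : cos x * (n.+1%:R * sin x ^+ n * cos x) =
    n.+1%:R * sin x ^+ n * (1 - sin x ^+ 2).
  by rewrite -(cos2Dsin2 x); ring.
rewrite (exprS (sin x) n.+1) (exprS (sin x) n); field.
by rewrite -natr1 -natr1; have := ler0n R n; lra.
Qed.

(** The integral of sin^n over [0, pi / 2]. *)
Definition wallis (R : realType) (n : nat) : R :=
  sin_pow_prim n (pi / 2) - sin_pow_prim n 0.

Lemma wallisSS (R : realType) (n : nat) :
  wallis R n.+2 = n.+1%:R / n.+2%:R * wallis R n.
Proof.
rewrite /wallis [sin_pow_prim n.+2 _]/= [sin_pow_prim n.+2 0]/=.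
by rewrite cos_pihalf sin0 expr0n /= mul0r mulr0 !subr0; ring.
Qed.

Lemma wallis_gt0 (R : realType) (n : nat) : 0 < wallis R n.
Proof.
have [k] := ubnP n; elim: k n => // k IH [|[|n]] nk.
- by rewrite /wallis /= subr0 divr_gt0 ?pi_gt0.
- by rewrite /wallis /= cos_pihalf cos0; lra.
- by rewrite wallisSS mulr_gt0 ?divr_gt0 ?ltr0n ?IH// ltnW.
Qed.

(** The difference of the two primitives has derivative sin^n (1 - sin), which
is nonnegative on [0, pi / 2]. *)
Lemma wallis_noninc (R : realType) (n : nat) : wallis R n.+1 <= wallis R n.
Proof.
have pi0 : 0 <= pi / 2 :> R by rewrite divr_ge0 ?pi_ge0.
have d (x : R) := is_deriveB (is_derive_sin_pow_prim n x)
                             (is_derive_sin_pow_prim n.+1 x).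
have := derive_ge0_le pi0 (fun x _ => d x).
rewrite /wallis => H.
suff /H : forall x : R, 0 <= x <= pi / 2 -> 0 <= sin x ^+ n - sin x ^+ n.+1.
  by rewrite !fctE; lra.
move=> x /andP[x0 xpi]; have sx0 : 0 <= sin x.
  by rewrite sin_ge0_pi// x0 /=; have := pi_ge0 R; lra.
by rewrite exprS subr_ge0 ler_piMl ?exprn_ge0 ?sin_le1.
Qed.

(** The recurrence makes the left-hand side independent of n.  Together with
monotonicity it pins down the square of [wallis R n] up to a factor
1 + O(1 / n). *)
Lemma wallis_mulS (R : realType) (n : nat) :
  n.+1%:R * (wallis R n * wallis R n.+1) = pi / 2.
Proof.
elim: n => [|n <-]; first by rewrite /wallis /= cos_pihalf cos0; ring.
by rewrite wallisSS; field; rewrite -natr1 -natr1; have := ler0n R n; lra.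
Qed.

Lemma wallis_double (R : realType) (n : nat) :
  wallis R n.*2 = pi / 2 * n.*2`!%:R / (2 ^+ n * n`!%:R) ^+ 2.
Proof.
elim: n => [|n IH]; first by rewrite /wallis /= fact0; field.
rewrite doubleS wallisSS IH !factS !(natrM, exprS).
have := ler0n R n; have := ltr0n R n`!; rewrite fact_gt0 => f0.
rewrite -!natr1 -mul2n natrM => n0; field.
by rewrite expf_neq0 /=; [apply/and3P; split; lra | lra].
Qed.

(** * Stirling's formula with an explicit error *)

(** The logarithm of n! / ((n / e)^n sqrt n), to be compared with
ln (2 pi) / 2. *)
Definition stirling_ln (R : realType) (n : nat) : R :=
  ln n`!%:R - (n%:R + 1 / 2) * ln n%:R + n%:R.

(** The difference is (n + 1 / 2) ln(1 + 1 / n) - 1, whose terms of order 1 and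
1 / n cancel.  The bound is written as a telescoping difference. *)
Lemma stirling_ln_step (R : realType) (n : nat) : (0 < n)%N ->
  `|stirling_ln R n - stirling_ln R n.+1| <= (n%:R^-1 - n.+1%:R^-1) / 2.
Proof.
move=> n_gt0; have n0 : 0 < n%:R :> R by rewrite ltr0n.
pose x : R := n%:R^-1; have x0 : 0 < x by rewrite invr_gt0.
have nE : n%:R = x^-1 by rewrite invrK.
have x1 : x <= 1 by rewrite invf_le1// ler1n.
have -> : stirling_ln R n - stirling_ln R n.+1 =
    (n%:R + 1 / 2) * ln (1 + x) - 1.
  have -> : 1 + x = n.+1%:R / n%:R by rewrite -natr1 /x; field; lra.
  rewrite /stirling_ln factS natrM !lnM ?lnV ?posrE ?invr_gt0 ?ltr0n ?fact_gt0//.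
  by rewrite -natr1; ring.
have -> : (n%:R^-1 - n.+1%:R^-1) / 2 = x ^+ 2 / (2 * (1 + x)) :> R.
  by rewrite -natr1 nE; field; lra.
have l := ln1p_ge (ltW x0); have u := ln1p_le (ltW x0); rewrite nE.
have y0 : 0 <= x^-1 + 1 / 2 :> R by rewrite -nE; lra.
have h : x ^+ 2 / 4 <= x ^+ 2 / (2 * (1 + x)).
  by rewrite ler_pM2l ?exprn_gt0// lef_pV2 ?posrE; lra.
apply: le_trans h; rewrite ler_norml; apply/andP; split.
  have := ler_wpM2l y0 l.
  have -> : (x^-1 + 1 / 2) * (x - x ^+ 2 / 2) = 1 - x ^+ 2 / 4 by field; lra.
  by lra.
have := ler_wpM2l y0 u.
have -> : (x^-1 + 1 / 2) * (x - x ^+ 2 / 2 + x ^+ 3 / 3) =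
  1 + x ^+ 2 / 12 + x ^+ 3 / 6 by field; lra.
have : x ^+ 3 <= x ^+ 2 by rewrite exprS ler_piMl // exprn_ge0 // ltW.
by lra.
Qed.

Lemma stirling_ln_dist (R : realType) (n k : nat) : (0 < n)%N ->
  `|stirling_ln R n - stirling_ln R (n + k)| <= (n%:R^-1 - (n + k)%:R^-1) / 2.
Proof.
move=> n0; elim: k => [|k IH]; first by rewrite addn0 !subrr normr0 mul0r.
have := @stirling_ln_step R (n + k) (ltn_addr _ n0); rewrite addnS => H.
apply: le_trans (ler_distD (stirling_ln R (n + k)) _ _) _.
by apply: le_trans (lerD IH H) _; rewrite -mulrDl addrA subrK.
Qed.

(** In 2 a(n) - a(2 n), with a = [stirling_ln], only the central binomial
coefficient survives, up to powers of 2 and n; it is a Wallis integral, and squeezing that integral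
between its neighbours gives the constant ln (2 pi) / 2. *)
Lemma stirling_ln_double (R : realType) (n : nat) : (0 < n)%N ->
  0 <= 2 * stirling_ln R n - stirling_ln R n.*2 - ln (2 * pi) / 2
    <= 1 / (4 * n%:R).
Proof.
move=> n_gt0; have n0 : 0 < n%:R :> R by rewrite ltr0n.
have pi0 := pi_gt0 R.
pose w := wallis R n.*2; have w0 : 0 < w by exact: wallis_gt0.
have p0 : 0 < pi / 2 :> R by lra.
have nn : n.*2%:R = 2 * n%:R :> R by rewrite -mul2n natrM.
have f0 m : (m`!%:R : R) \is Num.pos by rewrite posrE ltr0n fact_gt0.
have lnw : ln w = ln pi - ln 2 + ln n.*2`!%:R - 2 * (n%:R * ln 2 + ln n`!%:R).
  rewrite /w wallis_double !ln_div ?posrE ?mulr_gt0 ?divr_gt0 ?exprn_gt0 ?f0 //.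
  rewrite lnM ?lnXn ?lnM ?ln_div ?lnXn ?posrE ?mulr_gt0 ?exprn_gt0 ?ltr0n ?fact_gt0//.
  by rewrite lnV ?posrE//; ring.
have w_le : 2 * ln w <= ln (pi / 2) - ln (2 * n%:R).
  have : w ^+ 2 <= pi / 2 / (2 * n%:R).
    rewrite ler_pdivlMr ?mulr_gt0// -(wallis_mulS R n.*2.-1) prednK ?double_gt0//.
    have := wallis_noninc R n.*2.-1; rewrite prednK ?double_gt0// -/w nn => H.
    by rewrite mulrC ler_pM2l ?mulr_gt0// expr2 ler_pM2r.
  rewrite -ln_div ?posrE ?mulr_gt0// [2 * ln w]mulr_natl -lnXn//.
  by rewrite ler_ln ?posrE ?divr_gt0 ?mulr_gt0 ?exprn_gt0.
have q1 : 0 < 2 * n%:R + 1 :> R by lra.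
have w_ge : ln (pi / 2) - ln (2 * n%:R + 1) <= 2 * ln w.
  have : pi / 2 / (2 * n%:R + 1) <= w ^+ 2.
    rewrite ler_pdivrMr ?addr_gt0 ?mulr_gt0// -(wallis_mulS R n.*2) -natr1 nn.
    rewrite mulrC ler_pM2r ?addr_gt0 ?mulr_gt0// expr2 ler_pM2l//.
    exact: wallis_noninc.
  rewrite -ln_div ?posrE ?addr_gt0 ?mulr_gt0// [2 * ln w]mulr_natl -lnXn//.
  by rewrite ler_ln ?posrE ?(divr_gt0 p0 q1) ?exprn_gt0.
have y0 : 0 < 1 / (2 * n%:R) :> R by rewrite divr_gt0 ?mulr_gt0.
have l_le : ln (2 * n%:R + 1) - ln (2 * n%:R) <= 1 / (2 * n%:R) :> R.
  rewrite -ln_div ?posrE ?addr_gt0 ?mulr_gt0//.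
  have -> : (2 * n%:R + 1) / (2 * n%:R) = 1 + 1 / (2 * n%:R) :> R by field; lra.
  by apply: le_ln1Dx; lra.
move: w_le w_ge l_le; rewrite lnw /stirling_ln nn.
rewrite ln_div ?posrE// !lnM ?posrE// => w_le w_ge l_le.
have -> : 1 / (4 * n%:R) = (1 / (2 * n%:R)) / 2 :> R by field; lra.
move: (1 / (2 * n%:R)) l_le => z; lra.
Qed.

(** No limit has to be taken: a(n) differs from 2 a(n) - a(2 n) by
a(2 n) - a(n), which telescoping bounds by 1 / (4 n). *)
Lemma stirling_ln_bound (R : realType) (n : nat) : (0 < n)%N ->
  `|stirling_ln R n - ln (2 * pi) / 2| <= 1 / (2 * n%:R).
Proof.
move=> n_gt0; have n0 : 0 < n%:R :> R by rewrite ltr0n.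
have /andP[l u] := stirling_ln_double R n_gt0.
have := @stirling_ln_dist R n n n_gt0; rewrite addnn -mul2n natrM => H.
have E1 : (n%:R^-1 - (2 * n%:R)^-1) / 2 = 1 / (4 * n%:R) :> R by field; lra.
have E2 : 1 / (2 * n%:R) = 1 / (4 * n%:R) + 1 / (4 * n%:R) :> R by field; lra.
move: H l u; rewrite E1 E2 -mul2n; move: (1 / (4 * n%:R)) => z.
by rewrite !ler_norml => /andP[? ?] ? ?; apply/andP; split; lra.
Qed.

Lemma norm_expR_sub1 (R : realType) (x : R) : `|x| <= 1 / 2 ->
  `|expR x - 1| <= 2 * `|x|.
Proof.
rewrite ler_norml => /andP[x1 x2].
have e1 := expR_ge1Dx x; have e2 := expR_ge1Dx (- x).
have e3 : expR x <= 1 + x + 2 * x ^+ 2.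
  rewrite expRN in e2; have e0 := expR_gt0 x.
  have : expR x <= (1 - x)^-1 by rewrite -[leLHS]invrK lef_pV2 ?posrE ?invr_gt0//; lra.
  move=> /le_trans; apply; rewrite -[_^-1]mul1r ler_pdivrMr//; nra.
by have [x0|x0] := ger0P x; rewrite ler_norml; apply/andP; split; nra.
Qed.

Lemma stirling (R : realType) (n : nat) : (0 < n)%N ->
  `|Num.sqrt (2 * pi * n%:R) * (n%:R / expR 1) ^+ n / n`!%:R - 1| <= 1 / n%:R :> R.
Proof.
move=> n_gt0; have n0 : 0 < n%:R :> R by rewrite ltr0n.
have n1 : 1 <= n%:R :> R by rewrite ler1n.
have pi0 := pi_gt0 R; have B := stirling_ln_bound R n_gt0.
have p2 : 0 < 2 * pi * n%:R :> R by rewrite !mulr_gt0.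
have -> : Num.sqrt (2 * pi * n%:R) * (n%:R / expR 1) ^+ n / n`!%:R
    = expR (- (stirling_ln R n - ln (2 * pi) / 2)).
  apply: ln_inj; rewrite ?posrE ?expR_gt0 ?divr_gt0 ?mulr_gt0 ?sqrtr_gt0
    ?exprn_gt0 ?divr_gt0 ?expR_gt0 ?ltr0n ?fact_gt0//.
  rewrite expRK /stirling_ln ln_div ?lnM ?lnXn ?ln_div ?expRK ?posrE ?mulr_gt0
    ?sqrtr_gt0 ?exprn_gt0 ?divr_gt0 ?expR_gt0 ?ltr0n ?fact_gt0//.
  have : ln (Num.sqrt (2 * pi * n%:R)) *+ 2 = ln 2 + ln pi + ln n%:R :> R.
    by rewrite -lnXn ?sqrtr_gt0// sqr_sqrtr ?ltW// !lnM ?posrE ?mulr_gt0.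
  by move=> /(congr1 (fun z => z / 2)); rewrite -mulr_natl; lra.
have E : 1 / n%:R = 2 * (1 / (2 * n%:R)) :> R by field; lra.
rewrite E; apply: le_trans (norm_expR_sub1 _) _; rewrite normrN.
  apply: le_trans B _; rewrite ler_pM2l// lef_pV2 ?posrE; lra.
by rewrite ler_pM2l.
Qed.

(** * From the order statistic to a binomial tail *)

Lemma uniform_prob_lt (R : realType) (c : R) : 0 <= c <= 1 ->
  uniform_prob (@ltr01 R) `]-oo, c[ = c%:E.
Proof.
move=> /andP[c0 c1]; have mc : measurable (`]-oo, c[ : set R) by [].
have := integral_uniform (@ltr01 R) (f := EFin \o \1_(`]-oo, c[ : set R)).
rewrite integral_indic// setIT => ->; last 2 first.
- exact/measurable_EFinP/measurable_indic.
- by move=> x /=; rewrite lee_fin indicE.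
rewrite subr0 invr1 mul1e integral_indic//.
have -> : `]-oo, c[ `&` `[0, 1] = `[0, c[%classic :> set R.
  apply/seteqP; split => x /=; rewrite !in_itv /=.
    by move=> [xc /andP[-> _]].
  by move=> /andP[-> xc]; rewrite xc (ltW (lt_le_trans xc c1)).
apply: etrans (lebesgue_measure_itv _) _; rewrite /= lte_fin; case: ltP => [_|c_le0].
  by rewrite sube0.
by congr EFin; apply/le_anti; rewrite c0.
Qed.

Lemma uniform01_lt d (T : measurableType d) (R : realType) (P : probability T R)
  (X : {RV P >-> R}) (c : R) : uniform01 X -> 0 <= c <= 1 ->
  P (X @^-1` `]-oo, c[) = c%:E.
Proof.
move=> uX c01; rewrite -(uniform_prob_lt c01) -uX//.
Qed.

Lemma uniform01_ge d (T : measurableType d) (R : realType) (P : probability T R)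
  (X : {RV P >-> R}) (c : R) : uniform01 X -> 0 <= c <= 1 ->
  P (X @^-1` `[c, +oo[) = (1 - c)%:E.
Proof.
move=> uX c01; rewrite -setCitvl preimage_setC probability_setC.
  by rewrite uniform01_lt.
exact: (measurable_funPTI X (measurable_itv _)).
Qed.

(** In a sorted sample the values below c form an initial segment. *)
Lemma order_stat_ltP d (T : measurableType d) (R : realType) (P : probability T R)
  (n : nat) (U : 'I_n -> {RV P >-> R}) (i : nat) (c : R) (w : T) :
  (0 < i <= n)%N ->
  (order_stat U i w < c) = (i <= #|[set j | (U j w < c)%R]%SET|)%N.
Proof.
move=> /andP[i0 i_n]; rewrite /order_stat; set s := map _ _.
have ss : size s = n by rewrite size_map size_enum_ord.
have -> : #|[set j | (U j w < c)%R]%SET| = count (< c) (sort <=%R s).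
  rewrite count_sort /s count_map cardE.
  rewrite -size_filter; congr size; rewrite /enum_mem -filter_predI.
  by apply: eq_filter => j; rewrite /= inE andbT.
have so : sorted <=%R (sort <=%R s) by apply: sort_sorted; exact: le_total.
apply/idP/idP => H.
  rewrite leqNgt; apply/negP => C.
  have : c <= nth 0 (sort <=%R s) i.-1.
    apply: nth_count_ge => //; rewrite size_sort ss prednK// i_n andbT.
    by rewrite -ltnS prednK.
  by rewrite leNgt H.
by apply: nth_count_lt => //; rewrite prednK.
Qed.

(** The event is the intersection over all j of a half-line condition on U j:
below c for j in S, at least c otherwise.  So independence applies to the whole
family and the probability is a product. *)
Lemma prob_below_eq d (T : measurableType d) (R : realType) (P : probability T R)
  (n : nat) (U : 'I_n -> {RV P >-> R}) (c : R) (S : {set 'I_n}) :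
  iid_uniform01 U -> 0 <= c <= 1 ->
  let E := [set w | [set j | (U j w < c)%R]%SET = S] in
  measurable E /\ P E = (c ^+ #|S| * (1 - c) ^+ (n - #|S|))%:E.
Proof.
move=> [indU uU] c01 E.
pose B j := if j \in S then `]-oo, c[%classic else `[c, +oo[%classic : set R.
have mB j : measurable (B j) by rewrite /B; case: ifP.
have EE : E = \bigcap_(j in [set` [set: 'I_n]%SET]) (U j @^-1` B j).
  apply/seteqP; split => w.
    move=> /= ES j _; rewrite /B /= -ES inE.
    by case: (ltP (U j w) c) => h /=; rewrite in_itv /= ?h// andbT.
  move=> H; apply/setP => j; rewrite inE.
  have := H j (finset.in_setT j); rewrite /B /=; case: ifP => jS /=; rewrite in_itv /= ?andbT//.
  by rewrite leNgt => /negbTE.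
split.
  rewrite EE; apply: fin_bigcap_measurable => [|j _]; last exact: measurable_funPTI.
  exact: finite_finset.
rewrite EE indU//.
rewrite (eq_bigr (fun j => (if j \in S then c else 1 - c)%:E)); last first.
  by move=> j _; rewrite /B; case: ifP => _; rewrite ?uniform01_lt ?uniform01_ge.
rewrite prodEFin.
congr EFin.
rewrite (bigID (mem S)) /= (eq_bigr (fun=> c)); last by move=> j /andP[_ ->].
rewrite [X in _ * X](eq_bigr (fun=> 1 - c)); last by move=> j /andP[_ /negbTE ->].
rewrite !prodr_const; congr (_ ^+ _ * _ ^+ _).
  by apply: eq_card => j; rewrite -topredE /= finset.in_setT.
have -> : (n - #|S|)%N = #|~: S|%SET by rewrite [RHS]cardsCs finset.setCK card_ord.
by apply: eq_card => j; rewrite -topredE /= finset.in_setT inE.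
Qed.

(** Split the event according to the set S of indices whose value lies below c,
then group these sets by cardinality. *)
Lemma order_stat_prob d (T : measurableType d) (R : realType) (P : probability T R)
  (n : nat) (U : 'I_n -> {RV P >-> R}) (i : nat) (c : R) :
  iid_uniform01 U -> 0 <= c <= 1 -> (0 < i <= n)%N ->
  P [set w | order_stat U i w < c] =
    (\sum_(i <= k < n.+1) binomial_pmf n c k)%:E.
Proof.
move=> iidU c01 i_n.
pose r := [seq S : {set 'I_n} <- enum {: {set 'I_n}} | (i <= #|S|)%N].
pose E S := [set w | [set j | (U j w < c)%R]%SET = S].
have -> : [set w | order_stat U i w < c] = \bigcup_(S in [set` r]) E S.
  apply/seteqP; split => w /=; rewrite order_stat_ltP//.
    move=> H; exists [set j | (U j w < c)%R]%SET => //=.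
    by rewrite mem_filter H mem_enum.
  by move=> [S /=]; rewrite mem_filter => /andP[H _] ->.
rewrite measure_fin_bigcup//; last 2 first.
- by move=> S S' _ _ [w [<- <-]].
- by move=> S _; have [] := prob_below_eq S iidU c01.
rewrite -(fsbig_seq _ (fun S => P (E S))); last exact/filter_uniq/enum_uniq.
rewrite big_filter big_enum_cond /=.
rewrite (eq_bigr (fun S : {set 'I_n} => (c ^+ #|S| * (1 - c) ^+ (n - #|S|))%:E)); last first.
  by move=> S _; have [_] := prob_below_eq S iidU c01.
rewrite sumEFin; congr EFin.
have cS (S : {set 'I_n}) : (#|S| < n.+1)%N by rewrite ltnS -[leqRHS]card_ord max_card.
rewrite (partition_big (fun S : {set 'I_n} => Ordinal (cS S)) (fun k => i <= k)%N) //=.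
rewrite big_geq_mkord /=; apply: eq_bigr => k ik.
rewrite (eq_bigr (fun=> c ^+ k * (1 - c) ^+ (n - k))); last first.
  by move=> S /andP[_ /eqP <-].
rewrite sumr_const /binomial_pmf; congr (_ *+ _).
have -> : 'C(n, k) = #|[set A : {set 'I_n} | #|A| == k]%SET|.
  by rewrite card_draws card_ord.
apply: eq_card => S.
rewrite inE -topredE /= -val_eqE /=.
by case: eqP => [->|]; rewrite ?andbT ?andbF.
Qed.

(** * Poisson approximation of the binomial tail *)

Lemma bernoulli_ineq (R : realDomainType) (x : R) (n : nat) :
  0 <= x <= 1 -> 1 - n%:R * x <= (1 - x) ^+ n.
Proof.
move=> /andP[x0 x1]; elim: n => [|n IH]; first by rewrite mul0r subr0 expr0.
rewrite exprS -natr1; have n0 := ler0n R n.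
apply: le_trans (_ : (1 - x) * (1 - n%:R * x) <= _); first by nra.
by apply: ler_wpM2l => //; lra.
Qed.

Definition binomial_tail (R : realType) (n : nat) (c : R) (i : nat) : R :=
  \sum_(i <= k < n.+1) binomial_pmf n c k.

Lemma binomial_pmfS (R : realType) (n k : nat) (c : R) : (k < n)%N ->
  k.+1%:R * (1 - c) * binomial_pmf n c k.+1
  = (n - k)%:R * c * binomial_pmf n c k.
Proof.
move=> kn; rewrite /binomial_pmf /unstable.onem.
have E : k.+1%:R * 'C(n, k.+1)%:R = (n - k)%:R * 'C(n, k)%:R :> R.
  by rewrite -!natrM mul_bin_left.
rewrite -[_ *+ 'C(n, k.+1)]mulr_natr -[_ *+ 'C(n, k)]mulr_natr exprS.
have -> : (1 - c) ^+ (n - k) = (1 - c) * (1 - c) ^+ (n - k.+1).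
  by rewrite -exprS subnSK.
transitivity (c * c ^+ k * (1 - c) * (1 - c) ^+ (n - k.+1) * (k.+1%:R * 'C(n, k.+1)%:R)).
  by ring.
by rewrite E; ring.
Qed.

(** Termwise: for k >= i the ratio of the terms of rank k + 1 and k is at most
n c / (i (1 - c)). *)
Lemma binomial_tailS_le (R : realType) (n i : nat) (c : R) :
  (i <= n)%N -> 0 <= c < 1 ->
  i%:R * (1 - c) * binomial_tail n c i.+1 <= n%:R * c * binomial_tail n c i.
Proof.
move=> i_n /andP[c0 c1].
have p0 k : 0 <= binomial_pmf n c k.
  by apply: binomial_pmf_ge0; rewrite c0 ltW.
rewrite {1}/binomial_tail big_add1 /= mulr_sumr.
have -> : binomial_tail n c i =
    \sum_(i <= k < n) binomial_pmf n c k + binomial_pmf n c n.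
  by rewrite /binomial_tail big_nat_recr.
rewrite [leRHS]mulrDr ler_wpDr ?mulr_ge0// mulr_sumr.
rewrite big_nat [leRHS]big_nat; apply: ler_sum => k /andP[ik kn].
apply: (@le_trans _ _ (k.+1%:R * (1 - c) * binomial_pmf n c k.+1)).
  rewrite !ler_wpM2r ?subr_ge0 ?(ltW c1)// ler_nat ltnW//.
by rewrite binomial_pmfS// !ler_wpM2r// ler_nat leq_subr.
Qed.

Lemma binomial_tail_ge_pmf (R : realType) (n i : nat) (c : R) :
  (i <= n)%N -> 0 <= c <= 1 -> binomial_pmf n c i <= binomial_tail n c i.
Proof.
move=> i_n c01; rewrite /binomial_tail big_ltn// lerDl sumr_ge0// => k _.
exact: binomial_pmf_ge0.
Qed.

(** A geometric series bound without the series: write the tail from i as its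
first term plus the tail from i + 1, and bound the latter by
[binomial_tailS_le]. *)
Lemma binomial_tail_le_pmf (R : realType) (n i : nat) (c : R) :
  (i <= n)%N -> 0 <= c < 1 ->
  (i%:R * (1 - c) - n%:R * c) * binomial_tail n c i
    <= i%:R * (1 - c) * binomial_pmf n c i.
Proof.
move=> i_n c01; have := binomial_tailS_le i_n c01.
have -> : binomial_tail n c i = binomial_pmf n c i + binomial_tail n c i.+1.
  by rewrite /binomial_tail big_ltn.
by move: (binomial_tail n c i.+1) (binomial_pmf n c i) => a b; nra.
Qed.

Definition poisson_weight (R : realType) (x : R) (i : nat) : R :=
  x ^+ i * expR (- x) / i`!%:R.

Lemma ffact_bounds (R : realType) (n i : nat) : (0 < i <= n)%N ->
  (1 - (i%:R : R) ^+ 2 / n%:R) * n%:R ^+ i <= ((n ^_ i)%:R : R) <= (n%:R : R) ^+ i.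
Proof.
move=> /andP[i0 i_n]; have n0 : 0 < n%:R :> R by rewrite ltr0n (leq_trans i0).
have ub : (n ^_ i <= n ^ i)%N.
  rewrite ffact_prod -[X in (_ <= _ ^ X)%N]card_ord -prod_nat_const.
  by apply: leq_prod => j _; exact: leq_subr.
have lb : ((n - i) ^ i <= n ^_ i)%N.
  rewrite ffact_prod -[X in (_ ^ X <= _)%N]card_ord -prod_nat_const.
  by apply: leq_prod => j _; apply: leq_sub2l; exact: ltnW.
apply/andP; split; last by rewrite -natrX ler_nat.
have : (n - i)%:R ^+ i <= (n ^_ i)%:R :> R by rewrite -natrX ler_nat.
apply: le_trans.
have -> : (n - i)%:R = (1 - i%:R / n%:R) * n%:R :> R.
  by rewrite natrB//; field; lra.
rewrite exprMn ler_wpM2r ?exprn_ge0//.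
have -> : i%:R ^+ 2 / n%:R = i%:R * (i%:R / n%:R) :> R by field; lra.
apply: bernoulli_ineq; rewrite divr_ge0//= ler_pdivrMr// mul1r ler_nat//.
Qed.

(** With c = x / n, the power (1 - c)^n lies between (1 - n c^2) exp(-x) and
exp(-x), and the exponent n - i instead of n costs a factor (1 - c)^i, which
is at least 1 - i c.  Both n c^2 and i c are at most i^2 / n since x <= i. *)
Lemma expr_onem_bounds (R : realType) (n i : nat) (x : R) : (0 < i <= n)%N ->
  0 < x <= i%:R -> i%:R ^+ 2 / n%:R < 1 :> R ->
  (1 - i%:R ^+ 2 / n%:R) * expR (- x) <= (1 - x / n%:R) ^+ (n - i) /\
  (1 - i%:R ^+ 2 / n%:R) * (1 - x / n%:R) ^+ (n - i) <= expR (- x).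
Proof.
move=> /andP[i0 i_n] /andP[x0 xi]; set rho := _ / n%:R => rho1.
have n0 : 0 < n%:R :> R by rewrite ltr0n (leq_trans i0).
have iR : 1 <= i%:R :> R by rewrite ler1n.
set c := x / n%:R; have c0 : 0 < c by rewrite divr_gt0.
have nc : n%:R * c = x by rewrite /c; field; lra.
have nrho : n%:R * rho = i%:R ^+ 2 by rewrite /rho; field; lra.
have ic : i%:R * c <= rho.
  by rewrite -(ler_pM2l n0) nrho mulrCA nc expr2 ler_wpM2l.
have c1 : c < 1 by nra.
have e1c : 1 - c <= expR (- c) by exact: expR_ge1Dx.
have ex : expR (- x) = expR (- c) ^+ n by rewrite -expRM_natl mulrN nc.
split.
  have le1 : (1 - c) ^+ n <= (1 - c) ^+ (n - i).
    by apply: ler_wiXn2l; rewrite ?leq_subr//; lra.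
  apply: le_trans le1; rewrite ex.
  have le2 : (1 - c ^+ 2) * expR (- c) <= 1 - c.
    have := expR_ge1Dx c; have e0 := expR_gt0 c; rewrite expRN => h.
    rewrite ler_pdivrMr//; nra.
  have c2 : 0 <= c ^+ 2 <= 1 by rewrite exprn_ge0 ?expr_le1 ?ltW.
  apply: (@le_trans _ _ (((1 - c ^+ 2) * expR (- c)) ^+ n)); last first.
    by rewrite lerXn2r ?nnegrE ?mulr_ge0 ?expR_ge0//; lra.
  rewrite exprMn ler_wpM2r ?exprn_ge0 ?expR_ge0//.
  apply: le_trans (bernoulli_ineq n c2).
  have : n%:R * c ^+ 2 <= rho by rewrite expr2 mulrA nc; nra.
  by lra.
have c01 : 0 <= c <= 1 by rewrite !ltW.
apply: (@le_trans _ _ ((1 - c) ^+ i * (1 - c) ^+ (n - i))).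
  rewrite ler_wpM2r ?exprn_ge0 ?subr_ge0 ?(ltW c1)//.
  by apply: le_trans (bernoulli_ineq i c01); lra.
rewrite -exprD subnKC// ex lerXn2r ?nnegrE ?expR_ge0//; lra.
Qed.

(** The tail from i compared with the Poisson weight at i: two factors
1 - i^2 / n account for the falling factorial and for (1 - x / n)^(n - i),
and x / i for the terms of rank above i. *)
Lemma binomial_tail_poisson (R : realType) (n i : nat) (x : R) :
  (0 < i <= n)%N -> 0 < x <= i%:R -> i%:R ^+ 2 / n%:R < 1 :> R ->
  (1 - i%:R ^+ 2 / n%:R) ^+ 2 * poisson_weight x i
    <= binomial_tail n (x / n%:R) i /\
  (1 - i%:R ^+ 2 / n%:R - x / i%:R) * binomial_tail n (x / n%:R) i
    <= poisson_weight x i.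
Proof.
move=> i_n xi rho1; have [lo hi] := expr_onem_bounds i_n xi rho1.
have /andP[flo fhi] := ffact_bounds R i_n.
move: i_n xi rho1 lo hi flo fhi => /andP[i0 i_n] /andP[x0 xi].
set rho := _ / n%:R; set c := x / n%:R => rho1 lo hi flo fhi.
have n0 : 0 < n%:R :> R by rewrite ltr0n (leq_trans i0).
have iR : 1 <= i%:R :> R by rewrite ler1n.
have c0 : 0 < c by rewrite divr_gt0.
have nc : n%:R * c = x by rewrite /c; field; lra.
have nrho : n%:R * rho = i%:R ^+ 2 by rewrite /rho; field; lra.
have ic : c <= rho.
  rewrite -(ler_pM2l n0) nrho nc; nra.
have c1 : c < 1 by lra.
have f0 : 0 < i`!%:R :> R by rewrite ltr0n fact_gt0.
have pE : binomial_pmf n c i = (n ^_ i)%:R / n%:R ^+ i * (x ^+ i / i`!%:R) * (1 - c) ^+ (n - i).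
  rewrite /binomial_pmf /unstable.onem -mulr_natr -bin_ffact natrM /c exprMn exprVn.
  field; rewrite expf_neq0 ?gt_eqF//.
set F := _ / n%:R ^+ i in pE; set E := (1 - c) ^+ _ in pE lo hi.
have Flo : 1 - rho <= F by rewrite ler_pdivlMr ?exprn_gt0.
have Fhi : F <= 1 by rewrite ler_pdivrMr ?mul1r ?exprn_gt0.
have X0 : 0 < x ^+ i / i`!%:R by rewrite divr_gt0 ?exprn_gt0.
have E0 : 0 <= E by rewrite exprn_ge0//; lra.
have e0 := expR_gt0 (- x).
have r0 : 0 <= 1 - rho by rewrite subr_ge0 ltW.
have -> : poisson_weight x i = x ^+ i / i`!%:R * expR (- x).
  by rewrite /poisson_weight; ring.
move: X0 pE; set X := x ^+ i / _ => X0 pE.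
split.
  apply: le_trans (binomial_tail_ge_pmf i_n _); last by rewrite !ltW.
  rewrite pE.
  have -> : (1 - rho) ^+ 2 * (X * expR (- x)) = (1 - rho) * X * ((1 - rho) * expR (- x)) by ring.
  apply: ler_pM; rewrite ?(mulr_ge0 r0) ?(ltW X0) ?(ltW e0) ?lo//.
  by rewrite (ler_wpM2r (ltW X0)).
have q0 : 0 < i%:R * (1 - c) by rewrite mulr_gt0; lra.
have c01 : 0 <= c < 1 by rewrite c1 ltW.
have T0 : 0 <= binomial_tail n c i.
  by apply: le_trans (binomial_tail_ge_pmf i_n _); [apply: binomial_pmf_ge0|]; rewrite !ltW.
have := binomial_tail_le_pmf i_n c01; rewrite nc pE.
move: T0; move: (binomial_tail n c i) => T T0 HT.
have : (1 - rho) * (F * X * E) <= X * expR (- x).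
  have -> : (1 - rho) * (F * X * E) = F * X * ((1 - rho) * E) by ring.
  have F0 : 0 <= F by exact: le_trans Flo.
  apply: ler_pM; rewrite ?(mulr_ge0 F0) ?(mulr_ge0 r0) ?(ltW X0) ?hi//.
  by rewrite -[leRHS]mul1r (ler_wpM2r (ltW X0)).
apply: le_trans.
have xE : x = i%:R * (x / i%:R) by field; lra.
have k0 : 0 <= x / i%:R by rewrite divr_ge0// ltW.
move: HT; rewrite {1}xE -mulrBr -!mulrA ler_pM2l; last lra.
move: (x / i%:R) k0 (F * (X * E)) => k k0 p HT.
(* (1 - rho) (1 - c - k) exceeds (1 - c) (1 - rho - k) by k (rho - c) >= 0. *)
rewrite -(@ler_pM2l _ (1 - c)) ?subr_gt0//.
apply: (@le_trans _ _ ((1 - rho) * ((1 - c - k) * T))).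
  rewrite -subr_ge0; have -> : (1 - rho) * ((1 - c - k) * T) -
    (1 - c) * ((1 - rho - k) * T) = k * (rho - c) * T by ring.
  by rewrite !mulr_ge0// subr_ge0.
by rewrite [leRHS]mulrCA ler_wpM2l.
Qed.

(** * The critical value *)

(** Multiply by the conjugate d^2 + 2 i + d sqrt(..), which removes the
cancellation in the numerator of [hc_crit]: the product of the numerator and
its conjugate is 4 i^2 (1 + d^2 / n), and the factor d^2 + n cancels. *)
Lemma hc_crit_closed (R : realType) (n i : nat) (d : R) :
  (0 < i <= n)%N -> 0 < d ->
  let s := i%:R / d ^+ 2 in
  hc_crit i n d =
  i%:R * s / ((1 + 2 * s + Num.sqrt (1 + 4 * s * (1 - i%:R / n%:R))) / 2) / n%:R.
Proof.
move=> /andP[i0 i_n] d0 s; rewrite /hc_crit.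
have n0 : 0 < n%:R :> R by rewrite ltr0n (leq_trans i0).
have iR : 1 <= i%:R :> R by rewrite ler1n.
have iN : i%:R <= n%:R :> R by rewrite ler_nat.
have d2 : 0 < d ^+ 2 by rewrite exprn_gt0.
have s0 : 0 < s by rewrite divr_gt0//; lra.
have th : i%:R / n%:R <= 1 :> R by rewrite ler_pdivrMr ?mul1r.
have A0 : 0 <= 1 + 4 * s * (1 - i%:R / n%:R).
  by rewrite addr_ge0// mulr_ge0 ?subr_ge0// mulr_ge0// ltW.
have -> : d ^+ 2 + 4 * i%:R - 4 * i%:R ^+ 2 / n%:R =
    d ^+ 2 * (1 + 4 * s * (1 - i%:R / n%:R)).
  by rewrite /s; field; lra.
rewrite sqrtrM ?ltW// sqrtr_sqr gtr0_norm//.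
set r := Num.sqrt _.
have rr : r * r = 1 + 4 * s * (1 - i%:R / n%:R) by rewrite -expr2 sqr_sqrtr.
have r0 : 0 <= r by exact: sqrtr_ge0.
have iE : i%:R = s * d ^+ 2 by rewrite /s; field; lra.
have dn : d ^+ 2 + n%:R != 0 by rewrite gt_eqF// addr_gt0.
have rs : 1 + 2 * s + r != 0 by rewrite gt_eqF//; lra.
have n0' : n%:R != 0 :> R by rewrite gt_eqF.
apply: (canLR (mulfK _)); first by rewrite mulf_neq0.
clearbody s r; apply: (mulIf rs).
have -> : (d ^+ 2 + 2 * i%:R - d * (d * r)) * (1 + 2 * s + r) =
    d ^+ 2 * ((1 + 2 * s) ^+ 2 - r * r) by rewrite iE; ring.
by rewrite rr iE; field; apply/andP.
Qed.

(** sqrt(1 + 4 s) is 1 + 2 s up to O(s^2), and th, which stands for i / n, only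
perturbs it by O(s th), that is O(s^2) again. *)
Lemma crit_root_bounds (R : realType) (s th : R) :
  0 <= th <= s -> s <= 1 ->
  let y := (1 + 2 * s + Num.sqrt (1 + 4 * s * (1 - th))) / 2 in
  1 + 2 * s - 2 * s ^+ 2 <= y <= 1 + 2 * s.
Proof.
move=> /andP[th0 ths] s1; set r := Num.sqrt _ => /=.
have A0 : 0 <= 1 + 4 * s * (1 - th) by nra.
have rr : r ^+ 2 = 1 + 4 * s * (1 - th) by rewrite sqr_sqrtr.
have r0 : 0 <= r by exact: sqrtr_ge0.
have r1 : r <= 1 + 2 * s.
  rewrite -(@ler_pXn2r _ 2) ?nnegrE//; [rewrite rr; nra | lra].
suff r2 : 1 + 2 * s - 4 * s ^+ 2 <= r by apply/andP; split; lra.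
(* Squaring: (1 + 2 s - 4 s^2)^2 = 1 + 4 s - 4 s^2 - 16 s^3 (1 - s). *)
have [neg|pos] := leP (1 + 2 * s - 4 * s ^+ 2) 0; first exact: le_trans neg r0.
rewrite -(@ler_pXn2r _ 2) ?nnegrE// ?(ltW pos)// rr.
have s3 : 0 <= s ^+ 3 * (1 - s) by rewrite mulr_ge0 ?exprn_ge0; lra.
have sth : s * th <= s ^+ 2 by rewrite expr2 ler_wpM2l//; lra.
apply: (@le_trans _ _ (1 + 4 * s - 4 * s ^+ 2)); last lra.
rewrite -subr_ge0; have -> : 1 + 4 * s - 4 * s ^+ 2 - (1 + 2 * s - 4 * s ^+ 2) ^+ 2
  = 16 * (s ^+ 3 * (1 - s)) by ring.
lra.
Qed.

(** The coefficient 3 is 2 + 1: ln y is 2 s and s / y is s, up to O(s^2). *)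
Lemma crit_exponent_bounds (R : realType) (s y : R) : 0 <= s <= 1 ->
  1 + 2 * s - 2 * s ^+ 2 <= y <= 1 + 2 * s ->
  `|ln y + s / y - 3 * s| <= 6 * s ^+ 2.
Proof.
move=> /andP[s0 s1] /andP[y1 y2].
have z0 : 0 <= 2 * s - 2 * s ^+ 2 by nra.
have y0 : 1 <= y by lra.
have l2 : ln y <= 2 * s.
  by apply: le_trans (le_ln1Dx _); [rewrite ler_ln ?posrE|]; lra.
have l1 : 2 * s - 4 * s ^+ 2 <= ln y.
  apply: (@le_trans _ _ (ln (1 + (2 * s - 2 * s ^+ 2)))); last first.
    by rewrite ler_ln ?posrE; lra.
  apply: le_trans (ln1p_ge z0).
  have : (2 * s - 2 * s ^+ 2) ^+ 2 <= (2 * s) ^+ 2.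
    by rewrite ler_pXn2r ?nnegrE//; nra.
  by nra.
have g1 : s / y <= s by rewrite ler_pdivrMr; nra.
have g2 : s - 2 * s ^+ 2 <= s / y by rewrite ler_pdivlMr; nra.
by rewrite ler_norml; apply/andP; split; lra.
Qed.

(** * The exponent v *)

(** The v for which x^i exp(-x) = (i^2 / (2 u))^i exp(-i v), solved for v so
that this identity is exact; see [poisson_weightE]. *)
Definition poisson_exponent (R : realType) (u x : R) (i : nat) : R :=
  ln (i%:R ^+ 2 / (2 * u)) - ln x + x / i%:R.

Lemma poisson_weightE (R : realType) (u x : R) (i : nat) :
  0 < u -> 0 < x -> (0 < i)%N ->
  poisson_weight x i = (i%:R ^+ 2 / (2 * u)) ^+ i
    * expR (- (i%:R * poisson_exponent u x i)) / i`!%:R.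
Proof.
move=> u0 x0 i0; have iR : 0 < i%:R :> R by rewrite ltr0n.
have X0 : 0 < i%:R ^+ 2 / (2 * u) by rewrite divr_gt0 ?exprn_gt0 ?mulr_gt0.
rewrite /poisson_weight /poisson_exponent; congr (_ / _).
set X := _ / (2 * u) in X0 *.
have -> : - (i%:R * (ln X - ln x + x / i%:R)) =
    i%:R * ln x - i%:R * ln X - x by field; lra.
rewrite !expRB !expRM_natl !lnK ?posrE// expRN; field.
by rewrite expf_neq0 ?gt_eqF// expR_gt0.
Qed.

(** The expansion of v described at the top, with q / (2 u) = w and
i / (2 u) = sg.  The error bound is the leading term 2 w + 3 sg times a small
quantity, because v is needed up to a factor 1 + o(1). *)
Lemma hc_exponent_bounds (R : realType) (u q : R) (n i : nat) :
  0 < u -> 0 <= q <= 2 * u -> (0 < i <= n)%N -> i%:R <= 2 * u -> 8 * u <= n%:R ->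
  let w := q / (2 * u) in let sg := i%:R / (2 * u) in
  let x := n%:R * hc_crit i n ((2 * u + q) / Num.sqrt (2 * u)) in
  0 < x <= i%:R * sg /\
  `|poisson_exponent u x i - (2 * w + 3 * sg)| <= (w + 2 * sg) * (2 * w + 3 * sg).
Proof.
move=> u0 /andP[q0 qu] i_n iu un w sg x.
have /andP[i0 in'] := i_n.
have iR : 0 < i%:R :> R by rewrite ltr0n.
have n0 : 0 < n%:R :> R by rewrite ltr0n (leq_trans i0).
have u2 : 0 < 2 * u by rewrite mulr_gt0.
have w0 : 0 <= w by rewrite divr_ge0// ltW.
have w1 : w <= 1 by rewrite ler_pdivrMr ?mul1r.
have sg0 : 0 < sg by rewrite divr_gt0.
have sg1 : sg <= 1 by rewrite ler_pdivrMr ?mul1r.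
pose d := (2 * u + q) / Num.sqrt (2 * u).
have d0 : 0 < d by rewrite divr_gt0 ?sqrtr_gt0//; lra.
have d2 : d ^+ 2 = 2 * u * (1 + w) ^+ 2.
  rewrite expr_div_n sqr_sqrtr ?ltW// /w; field; lra.
pose s := i%:R / d ^+ 2.
have w2 : 1 <= (1 + w) ^+ 2 by nra.
have sE : sg = s * (1 + w) ^+ 2 by rewrite /s d2 /sg; field; lra.
have s0 : 0 < s by rewrite divr_gt0 ?exprn_gt0.
have ssg : s <= sg by rewrite sE ler_peMr// ltW.
have s1 : s <= 1 by exact: le_trans sg1.
have ths : (0 : R) <= i%:R / n%:R <= s.
  apply/andP; split; first by rewrite divr_ge0 ?ler0n.
  rewrite ler_pM2l// lef_pV2 ?posrE ?exprn_gt0// d2.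
  apply: le_trans un; have -> : 8 * u = 2 * u * 4 by ring.
  by rewrite ler_pM2l//; nra.
have yb := crit_root_bounds ths s1.
have xE := @hc_crit_closed R n i d i_n d0.
move: yb xE; rewrite -/s /=; set y := _ / 2 => yb xE.
have y1 : 1 <= y.
  by move: yb => /andP[yb _]; apply: le_trans yb; nra.
have {}xE : x = i%:R * s / y.
  by rewrite /x -/d xE; field; lra.
have s01 : 0 <= s <= 1 by rewrite s1 ltW.
have eb := crit_exponent_bounds s01 yb.
have y0 : 0 < y by lra.
have x0 : 0 < x by rewrite xE divr_gt0// mulr_gt0.
split.
  rewrite x0 xE ler_pdivrMr//= -mulrA ler_pM2l//.
  by apply: le_trans ssg _; rewrite ler_peMr// ltW.
have -> : poisson_exponent u x i = 2 * ln (1 + w) + (ln y + s / y).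
  rewrite /poisson_exponent.
  have -> : i%:R ^+ 2 / (2 * u) = x * y * (1 + w) ^+ 2.
    by rewrite xE /s d2; field; lra.
  have w3 : 0 < 1 + w by lra.
  have -> : x / i%:R = s / y by rewrite xE; field; lra.
  rewrite lnM ?posrE ?(mulr_gt0 x0 y0) ?exprn_gt0// lnM ?posrE// lnXn//.
  by rewrite mulr2n; ring.
have lw2 : ln (1 + w) <= w by apply: le_ln1Dx; lra.
have lw1 := ln1p_ge w0.
have ds : sg - s <= 2 * w * sg.
  by rewrite sE; nra.
have ss : s ^+ 2 <= sg ^+ 2 by rewrite ler_pXn2r ?nnegrE ?(ltW s0) ?(ltW sg0).
have P1 : 0 <= w * sg by rewrite mulr_ge0// ltW.
have P2 := sqr_ge0 w; have P3 := sqr_ge0 sg.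
have -> : (w + 2 * sg) * (2 * w + 3 * sg) =
  2 * w ^+ 2 + 7 * (w * sg) + 6 * sg ^+ 2 by ring.
move: eb; rewrite !ler_norml => /andP[e1 e2]; apply/andP; split; lra.
Qed.

(** * Growth of log log n and of the shift q *)

Lemma cvg_hc_u (R : realType) : @hc_u R n @[n --> \oo] --> +oo.
Proof.
apply/cvgryPgt => A; near=> n.
have h : expR (expR A) < n%:R by near: n; exact: nbhs_infty_gtr.
have n0 : 0 < n%:R :> R by apply: lt_trans h; exact: expR_gt0.
have h1 : expR A < ln n%:R by rewrite -[ltLHS]expRK ltr_ln ?posrE ?expR_gt0.
have h2 : 0 < ln n%:R :> R by apply: lt_trans h1; exact: expR_gt0.
by rewrite -[ltLHS]expRK /hc_u ltr_ln ?posrE ?expR_gt0.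
Unshelve. all: by end_near. Qed.

Lemma hc_u_cube_le (R : realType) (n : nat) : 0 < @hc_u R n ->
  @hc_u R n ^+ 3 / 6 <= n%:R.
Proof.
move=> u0.
have l0 : 0 < ln n%:R :> R.
  by rewrite ltNge; apply/negP => /ln0 h; move: u0; rewrite /hc_u h ltxx.
have n0 : 0 < n%:R :> R.
  by rewrite ltNge; apply/negP => /ln0 h; move: l0; rewrite h ltxx.
have le1 : expR (@hc_u R n) <= n%:R.
  rewrite /hc_u lnK ?posrE//; exact: ltW (ln_sublinear n0).
apply: le_trans le1; apply: le_trans (expR_ge1Dxn 2 (ltW u0)).
by rewrite lerDr.
Qed.

Lemma ln_le_sqrt_sqrt (R : realType) (x : R) : 0 < x ->
  ln x <= 4 * Num.sqrt (Num.sqrt x).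
Proof.
move=> x0; set y := Num.sqrt (Num.sqrt x).
have y0 : 0 < y by rewrite !sqrtr_gt0.
have xE : x = y ^+ 4 by rewrite (exprM _ 2 2) !sqr_sqrtr ?sqrtr_ge0// ltW.
rewrite {1}xE lnXn// -[_ *+ 4]mulr_natl ler_pM2l//.
exact: ltW (ln_sublinear y0).
Qed.

(** The numerator of [hc_d] is 2 u plus this quantity, so that
d^2 = 2 u (1 + q / (2 u))^2 for q = [hc_shift t n]. *)
Definition hc_shift (R : realType) (t : R) (n : nat) : R :=
  t + (ln (hc_u n) - ln pi) / 2.

(** ln u is at most 4 u^(1/4), hence o(sqrt u). *)
Lemma hc_shift_small (R : realType) (t : R) :
  hc_shift t n / Num.sqrt (hc_u n) @[n --> \oo] --> 0.
Proof.
have cu := @cvg_hc_u R.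
have csqrt (f : nat -> R) : f n @[n --> \oo] --> +oo ->
    Num.sqrt (f n) @[n --> \oo] --> +oo.
  move=> cf; apply/cvgryPgt => A; near=> n.
  have : A ^+ 2 < f n by near: n; move/cvgryPgt : cf; apply.
  move=> h; apply: le_lt_trans (ler_norm A) _.
  by rewrite -sqrtr_sqr ltr_sqrt// (le_lt_trans _ h)// sqr_ge0.
have cs := csqrt _ cu; have css := csqrt _ cs.
have pos (f : nat -> R) : f n @[n --> \oo] --> +oo -> \forall n \near \oo, 0 < f n.
  by move/cvgryPgt; apply.
have is0 : (Num.sqrt (@hc_u R n))^-1 @[n --> \oo] --> 0.
  by apply/gtr0_cvgV0 => //; exact: pos.
have iss0 : (Num.sqrt (Num.sqrt (@hc_u R n)))^-1 @[n --> \oo] --> 0.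
  by apply/gtr0_cvgV0 => //; exact: pos.
have c1 : (t - ln pi / 2) * (Num.sqrt (@hc_u R n))^-1 @[n --> \oo] --> 0.
  by rewrite -[X in _ --> X](mulr0 (t - ln pi / 2)); apply: cvgMr.
have c2 : 2 * (Num.sqrt (Num.sqrt (@hc_u R n)))^-1 @[n --> \oo] --> 0.
  by rewrite -[X in _ --> X](mulr0 2); apply: cvgMr.
have c3 : ln (@hc_u R n) / 2 / Num.sqrt (@hc_u R n) @[n --> \oo] --> 0.
  apply: (squeeze_cvgr _ (cvg_cst 0) c2); near=> n.
  have u1 : 1 < @hc_u R n by near: n; move/cvgryPgt : cu; apply.
  have u0 : 0 < @hc_u R n by lra.
  set v := Num.sqrt (hc_u n).
  have v0 : 0 < v by rewrite sqrtr_gt0.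
  have w0 : 0 < Num.sqrt v by rewrite sqrtr_gt0.
  apply/andP; split; first by rewrite divr_ge0 ?divr_ge0 ?ln_ge0 ?ltW.
  have E (z : R) : 0 < z -> 2 * z^-1 = 4 * z / 2 / z ^+ 2.
    by move=> z0; field; lra.
  rewrite (E _ w0) sqr_sqrtr ?(ltW v0)//.
  by rewrite ler_pM2r ?invr_gt0// ler_pM2r// ln_le_sqrt_sqrt.
have -> : (fun n => hc_shift t n / Num.sqrt (hc_u n)) = (fun n =>
    (t - ln pi / 2) * (Num.sqrt (hc_u n))^-1
    + ln (hc_u n) / 2 / Num.sqrt (hc_u n)).
  by apply/funext => n; rewrite /hc_shift; ring.
by rewrite -[X in _ --> X](addr0 0); apply: cvgD.
Unshelve. all: by end_near. Qed.

Lemma cvg0_le (R : realType) (f g : nat -> R) :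
  (\forall n \near \oo, `|f n| <= `|g n|) -> g n @[n --> \oo] --> (0 : R) ->
  f n @[n --> \oo] --> (0 : R).
Proof.
move=> fg /cvgr0Pnorm_le g0; apply/cvgr0Pnorm_le => e e0; near=> n.
by apply: (@le_trans _ _ `|g n|); near: n; [|exact: g0].
Unshelve. all: by end_near. Qed.

Lemma near_lt_hc_u (R : realType) (A : R) : \forall n \near \oo, A < @hc_u R n.
Proof. by have /cvgryPgt := @cvg_hc_u R; apply. Qed.

Lemma hc_shift_ratio (R : realType) (t : R) :
  hc_shift t n / (2 * hc_u n) @[n --> \oo] --> (0 : R).
Proof.
apply: cvg0_le (hc_shift_small t); near=> n.
have u1 : 1 < @hc_u R n by near: n; exact: near_lt_hc_u.
rewrite !normrM !normfV ler_wpM2l// (gtr0_norm (_ : 0 < 2 * hc_u n)); last lra.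
have s0 : 0 < Num.sqrt (@hc_u R n) by rewrite sqrtr_gt0; lra.
rewrite gtr0_norm// lef_pV2 ?posrE//; last lra.
have s1 : 1 <= Num.sqrt (@hc_u R n).
  by rewrite -sqrtr1 ler_sqrt ltW//; lra.
rewrite -{2}[hc_u n]sqr_sqrtr; [nra | lra].
Unshelve. all: by end_near. Qed.

Lemma near_hc_shift_ge0 (R : realType) (t : R) :
  \forall n \near \oo, 0 <= hc_shift t n.
Proof.
near=> n.
have h : expR (ln pi - 2 * t) < @hc_u R n by near: n; exact: near_lt_hc_u.
have u0 : 0 < @hc_u R n by apply: lt_trans h; exact: expR_gt0.
have : ln pi - 2 * t < ln (@hc_u R n).
  by rewrite -[ltLHS]expRK ltr_ln ?posrE// expR_gt0.
by rewrite /hc_shift; lra.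
Unshelve. all: by end_near. Qed.

(** i^2 / n is (i / u)^2 times u^2 / n, and n is at least u^3 / 6. *)
Lemma hc_rank_sqr_small (R : realType) (i : nat -> nat) :
  (i n)%:R / hc_u n @[n --> \oo] --> (0 : R) ->
  (i n)%:R ^+ 2 / n%:R @[n --> \oo] --> (0 : R).
Proof.
move=> i_small.
have c : ((i n)%:R / hc_u n) ^+ 2 @[n --> \oo] --> (0 : R).
  by rewrite -[X in _ --> X](mulr0 0); apply: cvgM.
apply: cvg0_le c; near=> n.
have u1 : 6 < @hc_u R n by near: n; exact: near_lt_hc_u.
have u0 : 0 < @hc_u R n by lra.
have n3 := hc_u_cube_le u0.
have n0 : 0 < n%:R :> R by apply: lt_le_trans n3; rewrite divr_gt0 ?exprn_gt0.
rewrite !ger0_norm; last 2 first.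
- by rewrite exprn_ge0// divr_ge0// ltW.
- by rewrite divr_ge0 ?exprn_ge0.
rewrite expr_div_n ler_wpM2l ?exprn_ge0// lef_pV2 ?posrE ?exprn_gt0//.
apply: le_trans n3; rewrite ler_pdivlMr// (exprSr _ 2) ler_wpM2l ?exprn_ge0 ?ltW//.
Unshelve. all: by end_near. Qed.

(** * Asymptotics of the level *)

(** The inequalities under which the bounds of the previous parts hold at a
given n; [8 * hc_u n <= n] ensures d^2 <= n. *)
Definition hc_regime (R : realType) (t : R) (n i : nat) : Prop :=
  [/\ 0 < @hc_u R n, 0 <= hc_shift t n <= 2 * hc_u n, (0 < i <= n)%N,
      i%:R <= 2 * @hc_u R n & 8 * @hc_u R n <= n%:R].

Lemma near_hc_regime (R : realType) (t : R) (i : nat -> nat) :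
  (forall n, (0 < n)%N -> (1 <= i n <= n)%N) ->
  (i n)%:R / hc_u n @[n --> \oo] --> (0 : R) ->
  \forall n \near \oo, hc_regime t n (i n).
Proof.
move=> i_range i_small; near=> n.
have u1 : 7 < @hc_u R n by near: n; exact: near_lt_hc_u.
have u0 : 0 < @hc_u R n by lra.
have q0 : 0 <= hc_shift t n by near: n; exact: near_hc_shift_ge0.
have n3 := hc_u_cube_le u0.
split=> //.
- rewrite q0 /=.
  have : `|hc_shift t n / (2 * hc_u n)| <= 1.
    by near: n; apply: cvgr0_norm_le; [exact: hc_shift_ratio|].
  move/(le_trans (ler_norm _)); rewrite ler_pdivrMr ?mul1r//; lra.
- apply: i_range; near: n; exact: nbhs_infty_gt.
- have : `|(i n)%:R / @hc_u R n| <= 1 by near: n; exact: cvgr0_norm_le.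
  by move/(le_trans (ler_norm _)); rewrite ler_pdivrMr ?mul1r//; lra.
- apply: le_trans n3; rewrite ler_pdivlMr//.
  have : 48 <= @hc_u R n ^+ 2 by nra.
  by rewrite (exprSr _ 2); nra.
Unshelve. all: by end_near. Qed.

Lemma hc_dE (R : realType) (t : R) (n : nat) :
  hc_d t n = (2 * hc_u n + hc_shift t n) / Num.sqrt (2 * hc_u n).
Proof. by rewrite /hc_d /hc_shift; congr (_ / _); ring. Qed.

Definition hc_mean (R : realType) (t : R) (n i : nat) : R :=
  n%:R * hc_crit i n (hc_d t n).

Lemma hc_mean_bounds (R : realType) (t : R) (n i : nat) : hc_regime t n i ->
  0 < hc_mean t n i <= i%:R * (i%:R / (2 * hc_u n)) /\
  `|poisson_exponent (hc_u n) (hc_mean t n i) i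
     - (2 * (hc_shift t n / (2 * hc_u n)) + 3 * (i%:R / (2 * hc_u n)))|
    <= (hc_shift t n / (2 * hc_u n) + 2 * (i%:R / (2 * hc_u n))) *
       (2 * (hc_shift t n / (2 * hc_u n)) + 3 * (i%:R / (2 * hc_u n))).
Proof.
move=> [u0 q_u i_n iu un].
by have := hc_exponent_bounds u0 q_u i_n iu un; rewrite /hc_mean hc_dE.
Qed.

Lemma hc_levelE (d : measure_display) (T : measurableType d) (R : realType)
  (P : probability T R) (t : R) (n i : nat) (U : 'I_n -> {RV P >-> R}) :
  iid_uniform01 U -> hc_regime t n i ->
  hc_level t U i = binomial_tail n (hc_mean t n i / n%:R) i.
Proof.
move=> iidU reg; have [/andP[x0 xi] _] := hc_mean_bounds reg.
case: reg => u0 _ /andP[i0 i_n] iu un.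
have n0 : 0 < n%:R :> R by lra.
have cE : hc_crit i n (hc_d t n) = hc_mean t n i / n%:R.
  by rewrite /hc_mean; field; lra.
rewrite /hc_level cE order_stat_prob//; last by rewrite i0.
rewrite divr_ge0 ?(ltW x0) ?(ltW n0)//= ler_pdivrMr// mul1r (le_trans xi)//.
have iN : i%:R <= n%:R :> R by rewrite ler_nat.
apply: le_trans iN; rewrite ler_piMr// ler_pdivrMr ?mul1r//; lra.
Qed.

(** [binomial_tail_poisson] squeezes the ratio between (1 - r)^2 and
1 / (1 - r - k), where r = i^2 / n and k = x / i <= i / u both vanish; its
distance to 1 is then at most 2 (r + i / u). *)
Lemma hc_level_poisson (R : realType) (t : R)
  (disp : nat -> measure_display) (T : forall n, measurableType (disp n))
  (P : forall n, probability (T n) R)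
  (U : forall n, 'I_n -> {RV (P n) >-> R}) (i : nat -> nat) :
  (forall n, iid_uniform01 (U n)) ->
  (forall n, (0 < n)%N -> (1 <= i n <= n)%N) ->
  (i n)%:R / hc_u n @[n --> \oo] --> (0 : R) ->
  hc_level t (U n) (i n) / poisson_weight (hc_mean t n (i n)) (i n) - 1
    @[n --> \oo] --> (0 : R).
Proof.
move=> iidU i_range i_small.
have rho0 := hc_rank_sqr_small i_small.
pose g n : R := (i n)%:R ^+ 2 / n%:R + (i n)%:R / hc_u n.
have g0 : g n @[n --> \oo] --> (0 : R).
  by rewrite -[X in _ --> X](addr0 0); apply: cvgD.
have g20 : 2 * g n @[n --> \oo] --> (0 : R).
  by rewrite -[X in _ --> X](mulr0 2); apply: cvgMr.
apply: cvg0_le g20; near=> n; apply: le_trans (ler_norm _).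
have reg : hc_regime t n (i n) by near: n; exact: near_hc_regime.
have g1 : `|g n| < 1 / 2 by near: n; apply: cvgr0_norm_lt => //; lra.
have [/andP[x0 xi] _] := hc_mean_bounds reg.
rewrite (hc_levelE (iidU n) reg).
move: reg => [u0 _ i_n iu un].
have /andP[i0 _] := i_n.
have iR : 0 < (i n)%:R :> R by rewrite ltr0n.
have n0 : 0 < n%:R :> R by lra.
have r0 : 0 <= (i n)%:R ^+ 2 / n%:R :> R by rewrite divr_ge0 ?exprn_ge0.
have s0 : 0 <= (i n)%:R / hc_u n :> R by rewrite divr_ge0 ?ltW.
move: g1; rewrite ger0_norm ?addr_ge0// /g => g1.
have xi' : 0 < hc_mean t n (i n) <= (i n)%:R.
  by rewrite x0 (le_trans xi)// ler_piMr// ler_pdivrMr ?mul1r//; lra.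
have xs : hc_mean t n (i n) / (i n)%:R <= (i n)%:R / hc_u n.
  rewrite ler_pdivrMr// mulrC; apply: le_trans xi _; rewrite ler_pM2l//.
  by rewrite ler_pM2l// lef_pV2 ?posrE; lra.
have rho1 : (i n)%:R ^+ 2 / n%:R < 1 :> R by lra.
have [lo hi] := binomial_tail_poisson i_n xi' rho1.
have W0 : 0 < poisson_weight (hc_mean t n (i n)) (i n).
  by rewrite divr_gt0 ?mulr_gt0 ?exprn_gt0 ?expR_gt0 ?ltr0n ?fact_gt0.
set W := poisson_weight _ _ in lo hi W0 *.
move: lo hi; set B := binomial_tail _ _ _.
set k := _ / (i n)%:R in xs *; set r := _ / n%:R in r0 rho1 g1 *.
set sg := _ / hc_u n in s0 xs g1 *.
rewrite -ler_pdivlMr// => lo hi.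
have {}hi : (1 - r - k) * (B / W) <= 1 by rewrite mulrA ler_pdivrMr// mul1r.
move: lo hi; move: (B / W) => z lo hi.
have z0 : 0 <= z by apply: le_trans lo; exact: sqr_ge0.
have {}hi : (1 - (r + sg)) * z <= 1.
  by apply: le_trans hi; rewrite ler_wpM2r//; lra.
rewrite ler_norml; apply/andP; split; first by nra.
rewrite lerBlDr -(@ler_pM2l _ (1 - (r + sg))); last lra.
apply: le_trans hi _; nra.
Unshelve. all: by end_near. Qed.

(** The relative error in [hc_exponent_bounds] is w + i / u, which tends
to 0. *)
Lemma hc_exponent_ratio (R : realType) (t : R) (i : nat -> nat) :
  (forall n, (0 < n)%N -> (1 <= i n <= n)%N) ->
  (i n)%:R / hc_u n @[n --> \oo] --> (0 : R) ->
  exists eps : nat -> R, eps n @[n --> \oo] --> (0 : R) /\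
    \forall n \near \oo,
      poisson_exponent (hc_u n) (hc_mean t n (i n)) (i n) =
      (ln (hc_u n) + 2 * t - ln pi + 3 * (i n)%:R) / (2 * hc_u n)
        * (1 + eps n).
Proof.
move=> i_range i_small.
pose m n : R := (ln (hc_u n) + 2 * t - ln pi + 3 * (i n)%:R) / (2 * hc_u n).
pose v n := poisson_exponent (hc_u n) (hc_mean t n (i n)) (i n).
have key : \forall n \near \oo, 0 < m n /\
    `|v n - m n| <=
      (hc_shift t n / (2 * hc_u n) + (i n)%:R / hc_u n) * m n.
  near=> n.
  have reg : hc_regime t n (i n) by near: n; exact: near_hc_regime.
  have [_] := hc_mean_bounds reg; move: reg => [u0 /andP[q0 _] /andP[i0 _] _ _].
  have iR : 0 < (i n)%:R :> R by rewrite ltr0n.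
  have -> : 2 * (hc_shift t n / (2 * hc_u n)) + 3 * ((i n)%:R / (2 * hc_u n)) = m n.
    by rewrite /m /hc_shift; field; lra.
  have -> : 2 * ((i n)%:R / (2 * hc_u n)) = (i n)%:R / hc_u n :> R.
    by field; lra.
  split=> //; rewrite /m divr_gt0 ?mulr_gt0//.
  by move: q0; rewrite /hc_shift; lra.
exists (fun n => v n / m n - 1); split; last first.
  near=> n; have m0 : 0 < m n by near: n; apply: filterS key => ? [].
  by rewrite -/(m n) -/(v n); field; lra.
have g0 : hc_shift t n / (2 * hc_u n) + (i n)%:R / hc_u n @[n --> \oo] --> (0 : R).
  by rewrite -[X in _ --> X](addr0 0); apply: cvgD => //; exact: hc_shift_ratio.
apply: cvg0_le g0; near=> n.
have [m0 h] : 0 < m n /\ `|v n - m n| <=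
  (hc_shift t n / (2 * hc_u n) + (i n)%:R / hc_u n) * m n by near: n.
apply: le_trans (ler_norm _).
have -> : v n / m n - 1 = (v n - m n) / m n by field; lra.
by rewrite normrM normfV (gtr0_norm m0) ler_pdivrMr.
Unshelve. all: by end_near. Qed.
(** Regroup (i^2 / (2 u))^i as ((e / 2) (i / u))^i (i / e)^i; the last factor
is the one in Stirling's formula. *)
Lemma poisson_weight_stirling (R : realType) (u x : R) (i : nat) :
  0 < u -> 0 < x -> (0 < i)%N ->
  poisson_weight x i =
    1 / Num.sqrt (2 * pi * i%:R) * (expR 1 / 2 * (i%:R / u)) ^+ i
    * expR (- (i%:R * poisson_exponent u x i))
    * (Num.sqrt (2 * pi * i%:R) * (i%:R / expR 1) ^+ i / i`!%:R).
Proof.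
move=> u0 x0 i0; rewrite (poisson_weightE u0)//.
have iR : 0 < i%:R :> R by rewrite ltr0n.
have f0 : i`!%:R != 0 :> R by rewrite pnatr_eq0 -lt0n fact_gt0.
have r0 : Num.sqrt (2 * pi * i%:R) != 0 :> R.
  by rewrite gt_eqF// sqrtr_gt0 !mulr_gt0 ?pi_gt0.
have -> : (i%:R ^+ 2 / (2 * u)) = (expR 1 / 2 * (i%:R / u)) * (i%:R / expR 1).
  by field; rewrite !gt_eqF ?expR_gt0.
by rewrite [in LHS]exprMn; field; rewrite f0.
Qed.

Theorem lemma4p1 (R : realType) (t : R)
  (disp : nat -> measure_display) (T : forall n, measurableType (disp n))
  (P : forall n, probability (T n) R)
  (U : forall n, 'I_n -> {RV (P n) >-> R})
  (iidU : forall n, iid_uniform01 (U n))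
  (i : nat -> nat)
  (i_range : forall n, (0 < n)%N -> (1 <= i n <= n)%N)
  (i_small : (i n)%:R / hc_u n @[n --> \oo] --> (0 : R)) :
  (exists v eps a b : nat -> R,
    [/\ eps n @[n --> \oo] --> (0 : R),
        \forall n \near \oo,
          v n = (ln (hc_u n) + 2 * t - ln pi + 3 * (i n)%:R) / (2 * hc_u n)
                * (1 + eps n),
        a =O_\oo (fun n => 1 / (i n)%:R : R),
        b n @[n --> \oo] --> (0 : R)
      & \forall n \near \oo,
          hc_level t (U n) (i n) =
            1 / Num.sqrt (2 * pi * (i n)%:R)
            * ((expR 1 / 2) * ((i n)%:R / hc_u n)) ^+ i n
            * expR (- ((i n)%:R * v n))
            * (1 + a n + b n)])
  /\
  ((fun n => (i n)%:R : R) =o_\oo (fun n => Num.sqrt (hc_u n) : R) ->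
   exists b : nat -> R,
     (b n @[n --> \oo] --> (0 : R)) /\
     \forall n \near \oo,
       hc_level t (U n) (i n) =
         ((i n)%:R ^+ 2 / (2 * hc_u n)) ^+ i n * (1 / (i n)`!%:R)
         * (1 + b n)).
Proof.
pose v n : R := poisson_exponent (hc_u n) (hc_mean t n (i n)) (i n).
pose b1 n : R :=
  hc_level t (U n) (i n) / poisson_weight (hc_mean t n (i n)) (i n) - 1.
have b1_0 : b1 n @[n --> \oo] --> (0 : R) by exact: hc_level_poisson.
have [eps [eps0 vE]] := hc_exponent_ratio t i_range i_small.
have near_reg := near_hc_regime t i_range i_small.
have levelE n : hc_regime t n (i n) -> hc_level t (U n) (i n) =
    poisson_weight (hc_mean t n (i n)) (i n) * (1 + b1 n).
  move=> reg; have [/andP[x0 _] _] := hc_mean_bounds reg.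
  rewrite /b1; field; rewrite gt_eqF//.
  by rewrite divr_gt0 ?mulr_gt0 ?exprn_gt0 ?expR_gt0 ?ltr0n ?fact_gt0.
split.
  pose a n : R := Num.sqrt (2 * pi * (i n)%:R) * ((i n)%:R / expR 1) ^+ i n
      / (i n)`!%:R - 1.
  have near_a : \forall n \near \oo, `|a n| <= 1 / (i n)%:R.
    near=> n; apply: stirling.
    by have [_ _ /andP[]] : hc_regime t n (i n) by near: n.
  (* (1 + a) (1 + b1) = 1 + a + b1 (1 + a), and a is bounded. *)
  exists v, eps, a, (fun n => b1 n * (1 + a n)); split=> //.
  - apply/eqO_exP; exists 1 => //; near=> n.
    have a1 : `|a n| <= 1 / (i n)%:R by near: n.
    by rewrite mul1r (ger0_norm (_ : 0 <= 1 / (i n)%:R)).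
  - have b20 : 2 * b1 n @[n --> \oo] --> (0 : R).
      by rewrite -[X in _ --> X](mulr0 2); apply: cvgMr.
    apply: cvg0_le b20; near=> n.
    have a1 : `|a n| <= 1 / (i n)%:R by near: n.
    have [_ _ /andP[i0 _] _ _] : hc_regime t n (i n) by near: n.
    have i1 : 1 / (i n)%:R <= 1 :> R.
      by rewrite ler_pdivrMr ?ltr0n// mul1r ler1n.
    rewrite !normrM mulrC ler_wpM2r// (ger0_norm (_ : 0 <= 2))//.
    by apply: le_trans (ler_normD _ _) _; rewrite normr1; lra.
  - near=> n; have reg : hc_regime t n (i n) by near: n.
    have [/andP[x0 _] _] := hc_mean_bounds reg.
    rewrite (levelE n reg); case: reg => u0 _ /andP[i0 _] _ _.
    rewrite (poisson_weight_stirling u0 x0 i0) -/(v n).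
    have -> : 1 + a n + b1 n * (1 + a n) = (1 + a n) * (1 + b1 n) by ring.
    rewrite [RHS]mulrA; congr (_ * _); congr (_ * _).
    by rewrite /a addrC subrK.
move=> /eqoP io.
have is0 : (i n)%:R / Num.sqrt (hc_u n) @[n --> \oo] --> (0 : R).
  apply/cvgr0Pnorm_le => e e0; near=> n.
  have u0 : 0 < Num.sqrt (@hc_u R n).
    by rewrite sqrtr_gt0; near: n; exact: near_lt_hc_u.
  have : `|(i n)%:R : R| <= e * `|Num.sqrt (@hc_u R n)| by near: n; exact: io.
  by rewrite normrM normfV (gtr0_norm u0) ler_pdivrMr.
(* i v is [g]: the first term below is i q / u, the second one 3 i^2 / (2 u). *)
have iv0 : (i n)%:R * v n @[n --> \oo] --> (0 : R).
  have c1 : (i n)%:R / Num.sqrt (hc_u n) * (hc_shift t n / Num.sqrt (hc_u n))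
      @[n --> \oo] --> (0 : R).
    by rewrite -[X in _ --> X](mulr0 0); apply: cvgM => //; exact: hc_shift_small.
  have c2 : (i n)%:R / Num.sqrt (hc_u n) * ((i n)%:R / Num.sqrt (hc_u n))
      @[n --> \oo] --> (0 : R).
    by rewrite -[X in _ --> X](mulr0 0); apply: cvgM.
  have {}c2 : 3 / 2 * ((i n)%:R / Num.sqrt (hc_u n) * ((i n)%:R / Num.sqrt (hc_u n)))
      @[n --> \oo] --> (0 : R).
    by rewrite -[X in _ --> X](mulr0 (3 / 2)); apply: cvgMr.
  have c3 : 1 + eps n @[n --> \oo] --> (1 : R).
    by rewrite -[X in _ --> X](addr0 1); apply: cvgD => //; exact: cvg_cst.
  pose g n : R := ((i n)%:R / Num.sqrt (hc_u n)
      * (hc_shift t n / Num.sqrt (hc_u n))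
    + 3 / 2 * ((i n)%:R / Num.sqrt (hc_u n) * ((i n)%:R / Num.sqrt (hc_u n))))
    * (1 + eps n).
  have c4 : g n @[n --> \oo] --> (0 : R).
    have := cvgM (cvgD c1 c2) c3; rewrite addr0 mul0r; exact.
  apply: cvg0_le c4; near=> n.
  have u0 : 0 < @hc_u R n by near: n; exact: near_lt_hc_u.
  have -> : v n = (ln (hc_u n) + 2 * t - ln pi + 3 * (i n)%:R) / (2 * hc_u n)
                * (1 + eps n) by near: n.
  have s0 : 0 < Num.sqrt (@hc_u R n) by rewrite sqrtr_gt0.
  have sE : @hc_u R n = Num.sqrt (hc_u n) ^+ 2 by rewrite sqr_sqrtr ?ltW.
  rewrite /g /hc_shift; move: (1 + eps n) (ln (hc_u n)) => e l.
  move: s0 sE; set z := Num.sqrt _; clearbody z => z0 ->.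
  by rewrite le_eqVlt; apply/orP; left; apply/eqP; congr `|_|; field; lra.
exists (fun n => expR (- ((i n)%:R * v n)) * (1 + b1 n) - 1); split.
  have c1 : expR (- ((i n)%:R * v n)) @[n --> \oo] --> (1 : R).
    rewrite -[X in _ --> X]expR0; apply: continuous_cvg; first exact: continuous_expR.
    by rewrite -[X in _ --> X]oppr0; apply: cvgN.
  have c2 : 1 + b1 n @[n --> \oo] --> (1 : R).
    by rewrite -[X in _ --> X](addr0 1); apply: cvgD => //; exact: cvg_cst.
  rewrite -[X in _ --> X](subrr (1 : R)) -[X in _ --> X - _](mulr1 1).
  by apply: cvgB; [exact: cvgM | exact: cvg_cst].
near=> n; have reg : hc_regime t n (i n) by near: n.
have [/andP[x0 _] _] := hc_mean_bounds reg.
rewrite (levelE n reg); case: reg => u0 _ /andP[i0 _] _ _.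
by rewrite (poisson_weightE u0 x0 i0) -/(v n); ring.
Unshelve. all: by end_near. Qed.
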